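(* There exist a quadratic vector field $Z_+(\cdot,\lambda)$ and a linear vector field $Z_-(\cdot,\lambda)$ on $\mathbb R^2$, depending smoothly on a parameter $\lambda\in\mathbb R$, and a compact domain $U\subset\mathbb R^2$, such that the following holds. For every $k\in\mathbb N$ there exist (a) a number $\epsilon_k>0$, (b) a regularization function $\phi_k:\mathbb R\to\mathbb R$, and (c) a continuous function $\lambda_c^k:[0,\epsilon_k[\,\to\mathbb R$, such that the regularized vector field $$Z(z)=Z_+(z,\lambda_c^k(\epsilon))\,\phi_k(y\epsilon^{-1})+Z_-(z,\lambda_c^k(\epsilon))\,\bigl(1-\phi_k(y\epsilon^{-1})\bigr),\qquad z=(x,y)\in\mathbb R^2,$$ has at least $k$ limit cycles contained in $U$ for all $\epsilon\in\,]0,\epsilon_k[$.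
   Context: A regularization function is a smooth ($C^\infty$) function $\phi:\mathbb R\to\mathbb R$ with $\phi'(s)>0$ for all $s\in\mathbb R$, $\phi(s)\to1$ as $s\to\infty$ and $\phi(s)\to0$ as $s\to-\infty$. A vector field on $\mathbb R^2$ is called quadratic (resp. linear) if its components are polynomials in $(x,y)$ of degree at most $2$ (resp. at most $1$, constant terms being allowed). A limit cycle is an isolated periodic orbit. The fields $Z_\pm$ and the domain $U$ do not depend on $k$. *)

(* Defs.v *)
From HB Require Import structures.
From mathcomp Require Import all_boot all_order all_algebra.
From mathcomp Require Import all_classical all_reals all_analysis.

Set Implicit Arguments.
Unset Strict Implicit.
Unset Printing Implicit Defensive.

Import Order.TTheory GRing.Theory Num.Theory.
Import numFieldNormedType.Exports.

Local Open Scope ring_scope.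
Local Open Scope classical_set_scope.

Definition smooth (R : realType) (f : R -> R) : Prop :=
  forall (n : nat) (x : R), derivable (f^`(n)) x 1.

Definition regularization_function (R : realType) (phi : R -> R) : Prop :=
  [/\ smooth phi,
      forall s : R, 0 < phi^`() s,
      phi s @[s --> +oo] --> (1 : R)
    & phi s @[s --> -oo] --> (0 : R)].

(* f(., l) is a polynomial in (x, y) of total degree at most d; smooth
   dependence on l means that its coefficients are smooth functions of l. *)
Definition smooth_poly_family (R : realType) (d : nat) (f : R * R -> R -> R) :
    Prop :=
  exists c : nat -> nat -> R -> R,
    (forall i j : nat, smooth (c i j)) /\
    forall (z : R * R) (l : R),
      f z l = \sum_(i < d.+1) \sum_(j < d.+1 | (i + j <= d)%N)
                c i j l * z.1 ^+ i * z.2 ^+ j.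

Definition smooth_poly_vector_field (R : realType) (d : nat)
    (Z : R * R -> R -> R * R) : Prop :=
  smooth_poly_family d (fun z l => (Z z l).1) /\
  smooth_poly_family d (fun z l => (Z z l).2).

Definition quadratic_vector_field (R : realType) (Z : R * R -> R -> R * R) :=
  smooth_poly_vector_field 2 Z.

Definition linear_vector_field (R : realType) (Z : R * R -> R -> R * R) :=
  smooth_poly_vector_field 1 Z.

Definition regularized_vector_field (R : realType)
    (Zp Zm : R * R -> R -> R * R) (phi : R -> R) (eps l : R) (z : R * R) :
    R * R :=
  phi (z.2 * eps^-1) *: Zp z l + (1 - phi (z.2 * eps^-1)) *: Zm z l.

Definition integral_curve (R : realType) (Z : R * R -> R * R)
    (g : R -> R * R) : Prop :=
  forall t : R, is_derive t (1 : R) g (Z (g t)).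

(* Equilibria are not periodic orbits. *)
Definition periodic_orbit (R : realType) (Z : R * R -> R * R)
    (O : set (R * R)) : Prop :=
  exists (g : R -> R * R) (T : R),
    [/\ integral_curve Z g,
        0 < T,
        forall t : R, g (t + T) = g t,
        exists t : R, g t <> g 0
      & O = range g].

(* Isolated: some neighbourhood V of O is met by no other periodic orbit. *)
Definition limit_cycle (R : realType) (Z : R * R -> R * R)
    (O : set (R * R)) : Prop :=
  periodic_orbit Z O /\
  exists V : set (R * R),
    [/\ open V, O `<=` V
      & forall O' : set (R * R),
          periodic_orbit Z O' -> O' `&` V !=set0 -> O' = O].

Definition at_least_limit_cycles_in (R : realType) (k : nat)
    (Z : R * R -> R * R) (U : set (R * R)) : Prop :=
  exists O : 'I_k -> set (R * R),
    injective O /\ forall i : 'I_k, limit_cycle Z (O i) /\ O i `<=` U.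

(* The closure of a nonempty connected open set, and compact. *)
Definition compact_domain (R : realType) (U : set (R * R)) : Prop :=
  compact U /\
  exists V : set (R * R),
    [/\ open V, connected V, V !=set0 & U = closure V].

(* Main.v *)
Require Import Defs.
From HB Require Import structures.
From mathcomp Require Import all_boot all_order all_algebra.
From mathcomp Require Import all_classical all_reals all_analysis.
From mathcomp Require Import ring lra.

Set Implicit Arguments.
Unset Strict Implicit.
Unset Printing Implicit Defensive.

Import Order.TTheory GRing.Theory Num.Theory.
Import numFieldNormedType.Exports.

Local Open Scope ring_scope.
Local Open Scope classical_set_scope.

(** The two fields are chosen so that the parameter only rescales the picture.
    Their components are homogeneous of degree two in [(x, y, l)], so with
    [l = eps] the substitution [x = eps * u], [y = eps * Y] turns the
    regularized field into [eps] times a field in [(u, Y)] that does not depend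
    on [eps].
    It is therefore enough that this one planar field has infinitely many limit
    cycles; the first [k] of them, shrunk by a small [eps], fit in a fixed box.
    Neither the smoothing function nor the curve [l = eps] has to depend on [k].

    The local model is the quadratic system
      [u' = 1 - u^2 - 2 V + u V],  [V' = u (2 - u - V)],
    for which the unit circle [E = u^2 + V^2 - 1 = 0] is invariant, since
    [E' = - 2 u E].  Because [V'] has the factor [u] as well, the average of
    [- 2 u] along an orbit can be made visible: [Lam = E / (2 - V)^2] satisfies
      [Lam' = - 2 u^2 / (2 - V) * Lam].
    Hence [Lam^2] never increases on the strip [|V| < 2].  The set
    [|V| < 3/2, |Lam| < 1/10] cannot be left in forward time, and a periodic
    orbit that meets it has [Lam^2] constant, so it is an equilibrium or lies on
    the circle ([trap_forward], [trapped_periodic]).  This isolates the circle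
    without any Poincare map.  That the circle is a full periodic orbit, and the
    only one it contains, follows from integrating the angular speed
    ([angle_flow], [circle_solution_surjective]).

    The model is written as [Q + p W] with [p = - V], where
    [W = (2 - u, u)] is affine and [Q = (1 - u^2, 2 u - u^2)].  Let [chi] be
    [1 / phi].  The regularization of the fields [W] and
    [W + Q + (mu Y - (mu + 2)) W] is [phi] times
    [Q + (chi (Y) + mu Y - (mu + 2)) W], so up to a positive change of time it
    is [Q + p W] with [p (Y) = chi (Y) + mu Y - (mu + 2)].  The multiplier [p]
    need not be monotone: a decreasing [chi] is obtained from a saw-tooth [p]
    as soon as [mu] is large.  Taking [p] with slope [-1] and a zero in the
    middle of infinitely many strips, spaced by the period [4 pi], reproduces
    the same circle in every strip
    ([regularization_function_sawtooth], [regularized_field_strip],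
    [strip_circle_limit_cycle]). *)

(** * Derivatives and antiderivatives of real functions *)

Section calculus.
Context {R : realType}.
Implicit Types (f g : R -> R) (x y t : R).

(** The rules of differentiation, for functions given pointwise: they apply to
    lambda abstractions without first folding the operations on functions. *)
Lemma is_derive_add f g x df dg :
  is_derive x (1 : R) f df -> is_derive x (1 : R) g dg ->
  is_derive x (1 : R) (fun y => f y + g y) (df + dg).
Proof. by move=> ? ?; exact: (@is_deriveD _ _ _ f g). Qed.

Lemma is_derive_sub f g x df dg :
  is_derive x (1 : R) f df -> is_derive x (1 : R) g dg ->
  is_derive x (1 : R) (fun y => f y - g y) (df - dg).
Proof. by move=> ? ?; exact: (@is_deriveB _ _ _ f g). Qed.

Lemma is_derive_opp f x df :
  is_derive x (1 : R) f df -> is_derive x (1 : R) (fun y => - f y) (- df).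
Proof. by move=> ?; exact: (@is_deriveN _ _ _ f). Qed.

Lemma is_derive_mul f g x df dg :
  is_derive x (1 : R) f df -> is_derive x (1 : R) g dg ->
  is_derive x (1 : R) (fun y => f y * g y) (df * g x + f x * dg).
Proof.
move=> fd gd.
have -> : df * g x + f x * dg = f x *: dg + g x *: df.
  by rewrite addrC [df * _]mulrC.
exact: (@is_deriveM _ _ f g).
Qed.

Lemma is_derive_inv f x df : f x != 0 ->
  is_derive x (1 : R) f df ->
  is_derive x (1 : R) (fun y => (f y)^-1) (- (df / f x ^+ 2)).
Proof.
move=> fx0 fd.
have -> : - (df / f x ^+ 2) = - (f x) ^- 2 *: df.
  by rewrite scaleNr [df / _]mulrC.
exact: is_deriveV.
Qed.

Lemma is_derive_const (c : R) x : is_derive x (1 : R) (fun=> c) (0 : R).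
Proof. exact: is_derive_cst. Qed.

Lemma is_derive_var x : is_derive x (1 : R) (fun y => y) (1 : R).
Proof. exact: is_derive_id. Qed.

Lemma is_derive_comp f g x df dg :
  is_derive (g x) (1 : R) f df -> is_derive x (1 : R) g dg ->
  is_derive x (1 : R) (fun y => f (g y)) (df * dg).
Proof. by move=> ? ?; exact: is_derive1_comp. Qed.

Lemma is_derive_continuous f x df :
  is_derive x (1 : R) f df -> {for x, continuous f}.
Proof. by move=> [d _]; exact/differentiable_continuous/derivable1_diffP. Qed.

Lemma is_derive_nincr f df (a b : R) : a <= b ->
  (forall x, a <= x <= b -> is_derive x (1 : R) f (df x)) ->
  (forall x, a < x < b -> df x <= 0) -> f b <= f a.
Proof.
move=> ab fd df0.
have cf : {within `[a, b], continuous f}.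
  apply: continuous_in_subspaceT => x; rewrite inE/= in_itv/= => xab.
  exact: is_derive_continuous (fd _ xab).
have fd' x : x \in `]a, b[%R -> is_derive x (1 : R) f (df x).
  by rewrite in_itv/= => /andP[/ltW ax /ltW xb]; apply: fd; rewrite ax.
have [<-//|anb] := eqVneq a b.
have [|c] := MVT _ fd' cf; first by rewrite lt_neqAle anb.
rewrite in_itv/= => cab; rewrite -subr_le0 => ->.
by apply: mulr_le0_ge0; [exact: df0|rewrite subr_ge0].
Qed.

Lemma is_derive0_eq f (a b : R) : a <= b ->
  (forall x, a <= x <= b -> is_derive x (1 : R) f 0) -> f a = f b.
Proof.
move=> ab fd; apply/eqP.
rewrite eq_le (is_derive_nincr (df := fun=> 0) ab fd)//.
rewrite -(opprK (f a)) -(opprK (f b)) lerN2 andbT.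
apply: (@is_derive_nincr (fun x => - f x) (fun=> 0)) => // x xab.
by rewrite -oppr0; apply: is_derive_opp; exact: fd.
Qed.

Lemma is_derive_incr f df (a b : R) : a < b ->
  (forall x, a <= x <= b -> is_derive x (1 : R) f (df x)) ->
  (forall x, a < x < b -> 0 < df x) -> f a < f b.
Proof.
move=> ab fd df0.
have cf : {within `[a, b], continuous f}.
  apply: continuous_in_subspaceT => x; rewrite inE/= in_itv/= => xab.
  exact: is_derive_continuous (fd _ xab).
have fd' x : x \in `]a, b[%R -> is_derive x (1 : R) f (df x).
  by rewrite in_itv/= => /andP[/ltW ax /ltW xb]; apply: fd; rewrite ax.
have [c] := MVT ab fd' cf.
rewrite in_itv/= => cab; rewrite -subr_gt0 => ->.
by apply: mulr_gt0; [exact: df0|rewrite subr_gt0].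
Qed.

Lemma antiderivative_on f (n : R) : 0 < n -> continuous f ->
  exists F, F 0 = 0 /\ forall x, - n < x < n -> is_derive x (1 : R) F (f x).
Proof.
move=> n0 cf.
pose F x := (\int[lebesgue_measure]_(t in `[(- n), x]) (f t))%R.
have dF x : - n < x < n -> is_derive x (1 : R) F (f x).
  move=> /andP[nx xn].
  have intf : (@lebesgue_measure R).-integrable `[(- n), n] (EFin \o f).
    apply: continuous_compact_integrable; first exact: segment_compact.
    exact: continuous_subspaceT.
  have [dF F'] := @continuous_FTC1_closed R f (- n) x n xn intf nx (cf x).
  by rewrite -F' derive1E; exact: derivableP.
exists (fun x => F x - F 0); split; first by rewrite subrr.
move=> x xn; rewrite -[X in is_derive _ _ _ X]subr0.
exact: is_derive_sub (dF _ xn) (is_derive_const _ _).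
Qed.

(** The integrals from [- n] are normalised to vanish at [0]; they then agree
    where they are both antiderivatives, and patch to the whole line. *)
Lemma antiderivative f : continuous f ->
  exists F, F 0 = 0 /\ forall x, is_derive x (1 : R) F (f x).
Proof.
move=> cf.
have [F PF] := choice (fun n => antiderivative_on (ltr0Sn R n) cf).
have uniq n m x : - n.+1%:R < x < n.+1%:R -> - m.+1%:R < x < m.+1%:R ->
    F n x = F m x.
  move=> xn xm.
  have d y : `|y| <= `|x| -> is_derive y (1 : R) (fun z => F n z - F m z) 0.
    move=> yx; have yb (k : nat) : - k.+1%:R < x < k.+1%:R ->
        - k.+1%:R < y < (k.+1%:R : R).
      by rewrite -!ltr_norml; exact: le_lt_trans.
    by rewrite -(subrr (f y)); apply: is_derive_sub; apply: (PF _).2; apply: yb.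
  have FB0 : F n 0 - F m 0 = 0 by rewrite (PF n).1 (PF m).1 subrr.
  apply/eqP; rewrite -subr_eq0 -FB0; apply/eqP.
  have [x0|/ltW x0] := leP 0 x; [apply/esym|].
    apply: (@is_derive0_eq (fun z => F n z - F m z)) => // y /andP[y0 yx].
    by apply: d; rewrite !ger0_norm.
  apply: (@is_derive0_eq (fun z => F n z - F m z)) => // y /andP[xy y0].
  by apply: d; rewrite !ler0_norm// lerN2.
have big x : exists n : nat, - n.+1%:R < x < n.+1%:R.
  exists (Num.truncn `|x|); rewrite -ltr_norml.
  by have /andP[] := truncn_itv (normr_ge0 x).
have [N PN] := choice big.
exists (fun x => F (N x) x); split; first exact: (PF _).1.
move=> x; apply: near_eq_is_derive ((PF (N x)).2 x (PN x)).
have : \forall y \near x, - (N x).+1%:R < y < (N x).+1%:R.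
  have /andP[a b] := PN x.
  by apply: filterS2 (lt_nbhsr a) (lt_nbhsl b) => y ay yb; rewrite ay.
by apply: filterS => y yN; apply: uniq.
Qed.

End calculus.

(** * The trapping region of the invariant circle *)

Section hyperbolic_circle.
Context {R : realType}.

(** The last two bounds say [|Lam| < 1/10] for [Lam = E / (2 - y)^2], without
    the division.  The constants satisfy one requirement: at [|y| = 3/2] one has
    [Lam >= (5/4) / (49/4) > 1/10], so the region does not reach the lines
    [|y| = 3/2]. *)
Definition trap (x y : R) : Prop :=
  [/\ - (3 / 2) < y, y < 3 / 2, - (2 - y) ^+ 2 < 10 * (x ^+ 2 + y ^+ 2 - 1)
    & 10 * (x ^+ 2 + y ^+ 2 - 1) < (2 - y) ^+ 2].

Lemma open_lt_comp {X : topologicalType} (f g : X -> R) :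
  continuous f -> continuous g ->
  open [set z | f z < g z].
Proof.
move=> cf cg.
have -> : [set z | f z < g z] = (fun z => g z - f z) @^-1` [set x | 0 < x].
  by apply/seteqP; split=> z /=; rewrite subr_gt0.
apply: open_comp; last exact: open_gt.
by move=> z _; apply: (@continuousB _ _ _ g f); [exact: cg|exact: cf].
Qed.

Lemma continuous_mulf {X : topologicalType} (f g : X -> R) :
  continuous f -> continuous g ->
  continuous (fun z => f z * g z).
Proof. by move=> cf cg z; exact: (@continuousM _ _ f g _ (cf z) (cg z)). Qed.

Lemma continuous_addf {X : topologicalType} (f g : X -> R) :
  continuous f -> continuous g ->
  continuous (fun z => f z + g z).
Proof. by move=> cf cg z; exact: (@continuousD _ _ _ f g _ (cf z) (cg z)). Qed.

Lemma continuous_oppf {X : topologicalType} (f : X -> R) : continuous f ->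
  continuous (fun z => - f z).
Proof. by move=> cf z; exact: (@continuousN _ _ _ f _ (cf z)). Qed.

Lemma continuous_constf {X : topologicalType} (c : R) :
  continuous (fun _ : X => c).
Proof. by move=> z; exact: cvg_cst. Qed.

Lemma open_trap (f g : R * R -> R) : continuous f -> continuous g ->
  open [set z | trap (f z) (g z)].
Proof.
move=> cf cg.
have cc := @continuous_constf (R * R)%type.
have -> : [set z | trap (f z) (g z)] =
    [set z | - (3 / 2) < g z] `&` [set z | g z < 3 / 2] `&`
    ([set z | - (2 - g z) ^+ 2 < 10 * (f z ^+ 2 + g z ^+ 2 - 1)] `&`
     [set z | 10 * (f z ^+ 2 + g z ^+ 2 - 1) < (2 - g z) ^+ 2]).
  by apply/seteqP; split=> [z []|z [[? ?] [? ?]]].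
have c2g := continuous_addf (cc 2) (continuous_oppf cg).
have csq := continuous_mulf c2g c2g.
have cE := continuous_mulf (cc 10) (continuous_addf
  (continuous_addf (continuous_mulf cf cf) (continuous_mulf cg cg)) (cc (-1))).
apply: openI; apply: openI.
- exact: open_lt_comp (cc _) cg.
- exact: open_lt_comp cg (cc _).
- exact: open_lt_comp (continuous_oppf csq) cE.
- exact: open_lt_comp cE csq.
Qed.

Lemma trap_closed_edge (x y : R) : - (3 / 2) <= y -> y <= 3 / 2 ->
  - (2 - y) ^+ 2 < 10 * (x ^+ 2 + y ^+ 2 - 1) ->
  10 * (x ^+ 2 + y ^+ 2 - 1) < (2 - y) ^+ 2 -> trap x y.
Proof.
move=> y1 y2 E1 E2; split=> //.
- rewrite lt_neqAle y1 andbT; apply/eqP => yE; move: E2; rewrite -yE.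
  by have := sqr_ge0 x; nra.
- rewrite lt_neqAle y2 andbT; apply/eqP => yE; move: E2; rewrite yE.
  by have := sqr_ge0 x; nra.
Qed.

Variables (u V a : R -> R).
Hypothesis a_gt0 : forall t, 0 < a t.
Hypothesis contu : continuous u.
Hypothesis contV : continuous V.
Hypothesis du : forall t, - 2 < V t < 2 -> is_derive t (1 : R) u
  (a t * (1 - u t ^+ 2 - 2 * V t + u t * V t)).
Hypothesis dV : forall t, - 2 < V t < 2 -> is_derive t (1 : R) V
  (a t * (u t * (2 - u t - V t))).

Let lam t := (u t ^+ 2 + V t ^+ 2 - 1) / (2 - V t) ^+ 2.

Let dlam t : - 2 < V t < 2 -> is_derive t (1 : R) (fun s => lam s * lam s)
  (- (4 * a t * u t ^+ 2 / (2 - V t) * lam t ^+ 2)).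
Proof.
move=> Vt; have Du := du Vt; have DV := dV Vt.
have V2 : 2 - V t != 0 by lra.
have D2V := is_derive_sub (is_derive_const 2 t) DV.
have Dsq := is_derive_mul D2V D2V.
have Dden := is_derive_inv (f := fun s => (2 - V s) * (2 - V s))
  (mulf_neq0 V2 V2) Dsq.
have Dnum := is_derive_sub (is_derive_add (is_derive_mul Du Du)
  (is_derive_mul DV DV)) (is_derive_const 1 t).
have Dlam := is_derive_mul Dnum Dden.
apply: is_derive_eq (is_derive_mul Dlam Dlam) _.
by rewrite /lam; field.
Qed.

Let lam_le s t : s <= t -> (forall r, s <= r <= t -> - 2 < V r < 2) ->
  lam t * lam t <= lam s * lam s.
Proof.
move=> st Vb; apply: is_derive_nincr st (fun r rst => dlam (Vb r rst)) _.
move=> r /andP[sr rt]; rewrite oppr_le0.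
have Vr : - 2 < V r < 2 by apply: Vb; rewrite !ltW.
rewrite mulr_ge0// ?sqr_ge0// mulr_ge0// ?invr_ge0; last by lra.
by rewrite mulr_ge0// ?sqr_ge0// mulr_ge0// ltW.
Qed.

Let trap_lam t : - 2 < V t < 2 ->
  (- (2 - V t) ^+ 2 < 10 * (u t ^+ 2 + V t ^+ 2 - 1) /\
  10 * (u t ^+ 2 + V t ^+ 2 - 1) < (2 - V t) ^+ 2) <-> lam t * lam t < 1 / 100.
Proof.
move=> Vt; have d0 : 0 < (2 - V t) ^+ 2 by rewrite exprn_gt0//; lra.
have -> : u t ^+ 2 + V t ^+ 2 - 1 = lam t * (2 - V t) ^+ 2.
  by rewrite /lam divfK// gt_eqF.
set D := (2 - V t) ^+ 2 in d0 *; set l := lam t.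
have -> : (- D < 10 * (l * D)) = (-1 < 10 * l).
  by rewrite mulrA -mulN1r ltr_pM2r.
have -> : (10 * (l * D) < D) = (10 * l < 1).
  by rewrite mulrA -[ltRHS]mul1r ltr_pM2r.
by split=> [[l1 l2]|l2]; [|split]; nra.
Qed.

(** At the first exit time the point is in the closed strip [|V| <= 3/2], and
    [Lam^2] has not increased up to then, so the point is still in the open
    region [trap]. *)
Lemma trap_forward t0 t : trap (u t0) (V t0) -> t0 <= t -> trap (u t) (V t).
Proof.
move=> trap0 t0t; apply: contrapT => ntrap.
pose S := [set s | t0 <= s /\ ~ trap (u s) (V s)].
have infS : has_inf S.
  by split; [exists t; split|exists t0 => s []].
(* [m] is the first exit time. *)
pose m := inf S.
have t0m : t0 <= m by apply: lb_le_inf; [exists t; split|move=> s []].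
have trap_lt s : t0 <= s -> s < m -> trap (u s) (V s).
  move=> t0s sm; apply: contrapT => nt; move: sm; rewrite ltNge => /negP; apply.
  by apply: ge_inf; [exact: infS.2|split].
have Vm : - (3 / 2) <= V m <= 3 / 2.
  have [->|mt0] := eqVneq m t0.
    by case: trap0 => /ltW -> /ltW ->.
  have {}t0m : t0 < m by rewrite lt_neqAle eq_sym mt0.
  have near_m : \forall s \near m^'-, - (3 / 2) <= V s <= 3 / 2.
    near=> s.
    have [| |/ltW -> /ltW ->//] := trap_lt s.
    - by near: s; exact: nbhs_left_ge.
    - by near: s; exact: nbhs_left_lt.
  have Vcvg : V s @[s --> m^'-] --> V m.
    by apply: cvg_at_left_filter; exact: contV.
  apply/andP; split.
    by apply: cvgr_to_ge Vcvg _; apply: filterS near_m => s /andP[].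
  by apply: cvgr_to_le Vcvg _; apply: filterS near_m => s /andP[].
have trap_m : trap (u m) (V m).
  have Vb r : t0 <= r <= m -> - 2 < V r < 2.
    move=> /andP[t0r]; rewrite le_eqVlt => /orP[/eqP ->|rm]; first by lra.
    by have [] := trap_lt _ t0r rm; lra.
  have := lam_le t0m Vb.
  have [_ _ e1 e2] := trap0.
  have /trap_lam[/(_ (conj e1 e2)) l0 _] : - 2 < V t0 < 2.
    by apply: Vb; rewrite lexx t0m.
  move=> /le_lt_trans/(_ l0) /trap_lam[]; first by apply: Vb; rewrite lexx t0m.
  by move: Vm => /andP[? ?]; exact: trap_closed_edge.
have : \forall s \near m, trap (u s) (V s).
  have cuV : (u s, V s) @[s --> m] --> (u m, V m).
    apply: (@cvg_pair _ _ _ _ (nbhs (u m)) (nbhs (V m))).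
      exact: contu.
    exact: contV.
  suff nbtrap : nbhs (u m, V m) [set z | trap z.1 z.2] by exact: (cuV _ nbtrap).
  apply: open_nbhs_nbhs; split=> //.
  by apply: open_trap => z; [exact: cvg_fst|exact: cvg_snd].
move=> /nbhs_ballP[e e0 mtrap].
have [s [t0s ntr] sm] := inf_adherent e0 infS.
have ms : m <= s by apply: ge_inf; [exact: infS.2|split].
apply: ntr; apply: mtrap; rewrite /ball/= distrC ger0_norm ?subr_ge0//.
by rewrite ltrBlDl.
Unshelve. all: by end_near. Qed.

Variable T : R.
Hypothesis T_gt0 : 0 < T.
Hypothesis perioduV : forall t, (u (t + T), V (t + T)) = (u t, V t).

Let periodn n t : (u (t + n%:R * T), V (t + n%:R * T)) = (u t, V t).
Proof.
elim: n => [|n IH]; first by rewrite mul0r addr0.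
by rewrite -natr1 mulrDl mul1r addrA perioduV.
Qed.

Let later s t : exists n : nat, t <= s + n%:R * T.
Proof.
have [ts|st] := leP t s; first by exists 0%N; rewrite mul0r addr0.
have q0 : 0 <= (t - s) / T by rewrite divr_ge0 ?subr_ge0 ?ltW.
have /andP[_ h] := truncn_itv q0; exists (Num.truncn ((t - s) / T)).+1.
by rewrite -lerBlDl -ler_pdivrMr// ltW.
Qed.

(** A periodic monotone function is constant, so [u^2 * Lam^2] vanishes
    identically while [Lam^2] is constant.  If [Lam] is not zero, then [u] is,
    hence [V] is constant and the orbit is an equilibrium. *)
Lemma trapped_periodic t0 : trap (u t0) (V t0) ->
  (exists t, (u t, V t) <> (u 0, V 0)) -> forall t, u t ^+ 2 + V t ^+ 2 = 1.
Proof.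
move=> trap0 [t1 nconst].
have trapT t : trap (u t) (V t).
  have [n t0n] := later t t0.
  by have := trap_forward trap0 t0n; have [-> ->] := periodn n t.
have Vb t : - 2 < V t < 2 by have [] := trapT t; lra.
pose L t := lam t * lam t.
have Lmono s t : s <= t -> L t <= L s by move=> st; exact: lam_le.
have Lcst t : L t = L 0.
  suff Lle s r : L s <= L r by apply/eqP; rewrite eq_le !Lle.
  have [n rn] := later s r.
  have -> : L s = L (s + n%:R * T).
    by rewrite /L /lam; have [-> ->] := periodn n s.
  exact: Lmono.
have d0 t : a t * u t ^+ 2 * lam t ^+ 2 = 0.
  have Ld : is_derive t (1 : R) L 0.
    rewrite (_ : L = fun=> L 0); last exact/funext.
    exact: is_derive_const.
  have := @derive_val _ _ _ _ _ _ _ Ld.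
  rewrite (@derive_val _ _ _ _ _ _ _ (dlam (Vb t))) => /eqP.
  rewrite oppr_eq0 mulf_eq0 mulf_eq0 invr_eq0 => /orP[/orP[|]|].
  - rewrite -mulrA mulf_eq0 => /orP[|/eqP ->]; last by rewrite mul0r.
    by rewrite pnatr_eq0.
  - by have := Vb t; lra.
  - by move=> /eqP ->; rewrite mulr0.
have [L0|L0] := eqVneq (L 0) 0.
  move=> t; have /eqP := Lcst t; rewrite L0 /L mulf_eq0 orbb /lam mulf_eq0.
  have V2 : 2 - V t != 0 by have := Vb t; lra.
  by rewrite invr_eq0 (expf_eq0 _ 2) (negbTE V2) orbF subr_eq0 => /eqP.
have u0 t : u t = 0.
  have l0 : lam t ^+ 2 != 0 by rewrite expr2 -/(L t) Lcst.
  have /eqP := d0 t.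
  rewrite (mulf_eq0 _ (lam t ^+ 2)) (negbTE l0) orbF mulf_eq0.
  by rewrite (gt_eqF (a_gt0 t)) expf_eq0 => /eqP.
have V0 t : V t = V 0.
  have dV0 s : is_derive s (1 : R) V 0.
    by have := dV (Vb s); rewrite u0 mul0r mulr0.
  have [t_ge0|/ltW t_le0] := leP 0 t; [apply/esym|];
    exact: is_derive0_eq.
by exfalso; apply: nconst; rewrite !u0 V0.
Qed.

End hyperbolic_circle.

(** * Smooth functions and flat functions *)

Section smooth_functions.
Context {R : realType}.
Implicit Types (f g : R -> R).

(** Exhibiting a derivative at each stage makes the closure properties below
    direct inductions, free of computations with iterated derivatives. *)
Fixpoint differentiable_times (n : nat) (f : R -> R) : Prop :=
  if n is m.+1 then
    exists2 f', (forall x, is_derive x (1 : R) f (f' x)) &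
      differentiable_times m f'
  else True.

Lemma differentiable_timesS n f :
  differentiable_times n.+1 f -> differentiable_times n f.
Proof.
elim: n f => [//|n IH] f [f' df /IH f'n].
by exists f'.
Qed.

Lemma smooth_derivatives f : (forall n, differentiable_times n f) -> smooth f.
Proof.
move=> fn n; move: {fn}(fn n.+1); elim: n f => [|n IH] f [f' df f'n] x.
  by have [] := df x.
have -> : f^`(n.+1) = f'^`(n).
  rewrite derive1Sn; congr (_^`(n)); apply/funext => y.
  by rewrite derive1E; exact: derive_val.
exact: IH.
Qed.

Lemma differentiable_times_const n (c : R) : differentiable_times n (fun=> c).
Proof.
elim: n c => [//|n IH] c; exists (fun=> 0) => // x; exact: is_derive_const.
Qed.

Lemma differentiable_times_var n : differentiable_times n (fun x : R => x).
Proof.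
case: n => [//|n]; exists (fun=> 1) => [x|]; first exact: is_derive_var.
exact: differentiable_times_const.
Qed.

Lemma differentiable_times_add n f g : differentiable_times n f ->
  differentiable_times n g -> differentiable_times n (fun x => f x + g x).
Proof.
elim: n f g => [//|n IH] f g [f' df f'n] [g' dg g'n].
exists (fun x => f' x + g' x); last exact: IH.
by move=> x; exact: is_derive_add.
Qed.

Lemma differentiable_times_mul n f g : differentiable_times n f ->
  differentiable_times n g -> differentiable_times n (fun x => f x * g x).
Proof.
elim: n f g => [//|n IH] f g fn gn.
have [f' df f'n] := fn; have [g' dg g'n] := gn.
exists (fun x => f' x * g x + f x * g' x) => [x|]; first exact: is_derive_mul.
apply: differentiable_times_add; apply: IH => //;
  exact: differentiable_timesS.
Qed.

Lemma differentiable_times_comp n f g : differentiable_times n f ->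
  differentiable_times n g -> differentiable_times n (fun x => f (g x)).
Proof.
elim: n f g => [//|n IH] f g [f' df f'n] gn.
have [g' dg g'n] := gn.
exists (fun x => f' (g x) * g' x) => [x|]; first exact: is_derive_comp.
apply: differentiable_times_mul => //; apply: IH => //.
exact: differentiable_timesS.
Qed.

Lemma differentiable_times_inv n f : (forall x, f x != 0) ->
  differentiable_times n f -> differentiable_times n (fun x => (f x)^-1).
Proof.
move=> f0; elim: n => [//|n IH] fn; have [f' df f'n] := fn.
have invn : differentiable_times n (fun x => (f x)^-1).
  by apply: IH; exact: differentiable_timesS.
exists (fun x => - 1 * (f' x * ((f x)^-1 * (f x)^-1))) => [x|].
  apply: is_derive_eq (is_derive_inv (f0 x) (df x)) _.
  by rewrite mulN1r expr2 invfM.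
apply: differentiable_times_mul; first exact: differentiable_times_const.
by apply: differentiable_times_mul => //; exact: differentiable_times_mul.
Qed.

Lemma differentiable_times_cos n :
  differentiable_times n cos /\ differentiable_times n (@sin R).
Proof.
elim: n => [//|n [cn sn]]; split; last first.
  by exists (@cos R) => // x; exact: is_derive_sin.
exists (fun x => - 1 * sin x) => [x|].
  by rewrite mulN1r; exact: is_derive_cos.
by apply: differentiable_times_mul => //; exact: differentiable_times_const.
Qed.

Lemma is_derive0_quadratic f (C : R) : f 0 = 0 ->
  (forall x, `|f x| <= C * x ^+ 2) -> is_derive (0 : R) (1 : R) f 0.
Proof.
move=> f0 fC; apply/is_derive1_caratheodory.
(* At [x = 0] the quotient is [f 0 / 0 = 0], the required value of the slope
   function. *)
exists (fun x => f x / x); split; last by rewrite invr0 mulr0.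
  move=> x; rewrite f0 !subr0; have [->|x0] := eqVneq x 0.
    by rewrite mulr0.
  by rewrite /GRing.scale/= divfK.
have C0 : 0 <= C.
  by have := fC 1; have := normr_ge0 (f 1); rewrite expr1n mulr1; lra.
apply/cvgrPdist_le => e e0; near=> x.
rewrite invr0 mulr0 sub0r normrN.
have [->|x0] := eqVneq x 0; first by rewrite invr0 mulr0 normr0 ltW.
rewrite normrM normfV ler_pdivrMr ?normr_gt0//; apply: le_trans (fC x) _.
rewrite -real_normK ?num_real// expr2 mulrA ler_wpM2r//.
apply: (@le_trans _ _ ((C + 1) * `|x|)).
  by rewrite ler_wpM2r// lerDl.
rewrite mulrC -ler_pdivlMr ?ltr_wpDl//; near: x.
have : 0 < e / (C + 1) by rewrite divr_gt0// ltr_wpDl.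
move=> d0; apply/nbhs_ballP; exists (e / (C + 1)) => // x.
by rewrite /ball/= sub0r normrN => /ltW.
Unshelve. all: by end_near. Qed.

(** The derivative of each member of this family is a combination of two other
    members, so that smoothness of all of them is proved at once. *)
Definition flat (n : nat) (x : R) : R :=
  if 0 < x then x ^- n * expR (- x^-1) else 0.

(** The bound comes from [x^(n+2) / (n+2)! <= exp x] at [1 / x]. *)
Lemma flat_le n x : `|flat n x| <= (n.+2)`!%:R * x ^+ 2.
Proof.
rewrite /flat; case: ifPn => [x0|_]; last first.
  by rewrite normr0 mulr_ge0// sqr_ge0.
have xn0 : 0 <= x ^- n by rewrite invr_ge0 exprn_ge0// ltW.
rewrite ger0_norm ?mulr_ge0 ?expR_ge0//.
have xV0 : 0 <= x^-1 by rewrite invr_ge0 ltW.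
have := expR_ge1Dxn n.+1 xV0.
rewrite expRN => h; rewrite -exprVn [leLHS]mulrC ler_pdivrMl ?expR_gt0//.
have {}h : x^-1 ^+ n.+2 / (n.+2)`!%:R <= expR x^-1.
  by apply: le_trans h; rewrite lerDr.
rewrite mulrC; apply: le_trans (ler_wpM2l _ h); last first.
  by rewrite mulr_ge0// sqr_ge0.
have f0 : (n.+2)`!%:R != 0 :> R by rewrite pnatr_eq0 -lt0n fact_gt0.
have x1 : x != 0 by rewrite gt_eqF.
rewrite [leRHS](_ : _ = x^-1 ^+ n)// (exprS x^-1 n.+1) (exprS x^-1 n).
by move: (x^-1 ^+ n) ((n.+2)`!%:R) f0 => y F F0; field; rewrite F0 x1.
Qed.

Lemma is_derive_flat n x :
  is_derive x (1 : R) (flat n) (- n%:R * flat n.+1 x + flat n.+2 x).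
Proof.
have [x0|x0|<-] := ltgtP 0 x.
- have xn0 : x != 0 by rewrite gt_eqF.
  have dX : is_derive x (1 : R) (fun y => y ^+ n) (n%:R * x ^+ n.-1).
    case: n => [|n]; first by rewrite mul0r; exact: is_derive_const.
    elim: n => [|n IH]; first by rewrite mul1r; exact: is_derive_var.
    rewrite (_ : (fun y => _) = (fun y => y * y ^+ n.+1)); last first.
      by apply/funext => y; rewrite exprS.
    apply: is_derive_eq (is_derive_mul (is_derive_var x) IH) _.
    by rewrite /= -!natr1 !exprS; ring.
  have dXV := is_derive_inv (f := fun y => y ^+ n) (expf_neq0 n xn0) dX.
  have dV := is_derive_opp
    (is_derive_inv (f := fun y => y) xn0 (is_derive_var x)).
  have dE := is_derive_mul dXV (is_derive_comp (is_derive_expR _) dV).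
  apply: near_eq_is_derive (is_derive_eq dE _).
    by apply: filterS (lt_nbhsr x0) => y y0; rewrite /flat y0.
  rewrite /flat x0.
  case: n {dX dXV dE} => [|n]; first by rewrite /= !expr0 !expr1; field.
  by rewrite /= !exprS -natr1; field; rewrite expf_neq0//.
- apply: near_eq_is_derive (is_derive_eq (is_derive_const 0 x) _).
    by apply: filterS (lt_nbhsl x0) => y y0; rewrite /flat lt_gtF.
  by rewrite /flat lt_gtF// mulr0 addr0.
- rewrite /flat ltxx mulr0 addr0; apply: is_derive0_quadratic (@flat_le n).
  by rewrite /flat ltxx.
Qed.

Lemma differentiable_times_flat m n : differentiable_times m (flat n).
Proof.
elim: m n => [//|m IH] n.
exists (fun x => - n%:R * flat n.+1 x + flat n.+2 x).
  exact: is_derive_flat.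
apply: differentiable_times_add => //; apply: differentiable_times_mul => //.
exact: differentiable_times_const.
Qed.

End smooth_functions.

(** * The building blocks of the saw-tooth *)

Section sawtooth.
Context {R : realType}.

Lemma flat0E (x : R) : 0 < x -> flat 0 x = expR (- x^-1).
Proof. by move=> x0; rewrite /flat x0 expr0 invr1 mul1r. Qed.

Lemma flat_ge0 n (x : R) : 0 <= flat n x.
Proof.
rewrite /flat; case: ifPn => // x0.
by rewrite mulr_ge0 ?expR_ge0// invr_ge0 exprn_ge0// ltW.
Qed.

Lemma flat0_lt1 (x : R) : flat 0 x < 1.
Proof.
rewrite /flat; case: ifPn => // x0; rewrite expr0 invr1 mul1r.
by rewrite expR_lt1 oppr_lt0 invr_gt0.
Qed.

(** Smooth, bounded by [1], of period [4 pi], and zero exactly where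
    [cos (s / 2) >= 0]; this contains [|s| <= 2] because [pi >= 2]. *)
Definition cos_bump (s : R) : R := flat 0 (- cos (s / 2)).

Definition period : R := 4 * pi.

Lemma cos_bump_periodic (s : R) : cos_bump (s + period) = cos_bump s.
Proof.
rewrite /cos_bump (_ : (s + period) / 2 = s / 2 + pi *+ 2) ?cosD2pi//.
by rewrite /period -mulr_natr; field.
Qed.

Lemma cos_bump0 (s : R) : - 2 <= s <= 2 -> cos_bump s = 0.
Proof.
move=> s2; rewrite /cos_bump /flat; case: ifPn => //.
rewrite oppr_gt0 ltNge cos_ge0_pihalf//.
by have := @pihalf_ge1 R; lra.
Qed.

Lemma cos_bump_gt0 (s : R) : pi < s < 3 * pi -> 0 < cos_bump s.
Proof.
move=> s2; rewrite /cos_bump flat0E ?expR_gt0// oppr_gt0.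
rewrite -[s / 2](subrK pi) cosDpi oppr_lt0 cos_gt0_pihalf//; lra.
Qed.

Lemma differentiable_times_cos_bump n : differentiable_times n cos_bump.
Proof.
apply: differentiable_times_comp; first exact: differentiable_times_flat.
rewrite (_ : (fun _ => _) = (fun s => - 1 * cos (s * 2^-1))); last first.
  by apply/funext => s; rewrite mulN1r.
apply: differentiable_times_mul; first exact: differentiable_times_const.
apply: differentiable_times_comp; first exact: (differentiable_times_cos n).1.
apply: differentiable_times_mul; first exact: differentiable_times_var.
exact: differentiable_times_const.
Qed.

(** The antiderivative of [cos_bump] is a smooth staircase: it is flat on each
    strip and climbs by the same height [b] over each period. *)
Lemma staircase : exists (B : R -> R) (b : R),
  [/\ 0 < b,
      forall s, is_derive s (1 : R) B (cos_bump s),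
      forall s, - 2 <= s <= 2 -> B s = 0
    & forall (n : nat) s, - 2 <= s + n%:R * period <= 2 -> B s = - (n%:R * b)].
Proof.
have cb : continuous cos_bump.
  move=> s; have [b' db _] := differentiable_times_cos_bump 1.
  exact: is_derive_continuous (db s).
have [B [B0 dB]] := antiderivative cb.
have dBle s t : s <= t -> B s <= B t.
  move=> st; rewrite -lerN2.
  apply: (is_derive_nincr st (fun r _ => is_derive_opp (dB r))).
  by move=> r _; rewrite oppr_le0 flat_ge0.
have pi0 := @pi_gt0 R.
have flatB s : - 2 <= s <= 2 -> B s = 0.
  move=> /andP[s1 s2]; rewrite -B0; have [s0|/ltW s0] := leP 0 s.
    apply/esym/is_derive0_eq => // x /andP[x1 x2].
    by rewrite -(@cos_bump0 x) //; lra.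
  apply/is_derive0_eq => // x /andP[x1 x2].
  by rewrite -(@cos_bump0 x) //; lra.
have BD s : B (s + period) = B s + B period.
  have dd x : is_derive x (1 : R) (fun x => B (x + period) - B x) 0.
    have shift := is_derive_add (is_derive_var x) (is_derive_const period x).
    have dshift := is_derive_comp (g := fun x => x + period)
      (dB (x + period)) shift.
    apply: is_derive_eq (is_derive_sub dshift (dB x)) _.
    by rewrite cos_bump_periodic; ring.
  suff : B (s + period) - B s = B (0 + period) - B 0.
    by rewrite add0r B0 subr0 => <-; rewrite [B s + _]addrC subrK.
  exact: (@is_derive_0_is_cst _ (fun x => B (x + period) - B x)).
have BDn (n : nat) s : B (s + n%:R * period) = B s + n%:R * B period.
  elim: n => [|n IH]; first by rewrite !mul0r !addr0.
  by rewrite -natr1 !mulrDl !mul1r !addrA BD IH.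
exists B, (B period); split => //.
  have b1 : B pi < B (3 * pi).
    have lt : pi < 3 * pi :> R by lra.
    by apply: (is_derive_incr lt (fun x _ => dB x)) => x; exact: cos_bump_gt0.
  apply: le_lt_trans (lt_le_trans b1 _).
    by rewrite -B0; apply: dBle; rewrite ltW.
  by apply: dBle; rewrite /period; lra.
by move=> n s /flatB; rewrite BDn => /eqP; rewrite addr_eq0 => /eqP.
Qed.

(** A smooth increasing map onto the half-line below [1] that is the identity on
    negative numbers.  Precomposing with it bends a function that reaches the
    value [1] at [1] into one that tends to [1] at infinity, and changes nothing
    on the strips. *)
Definition ramp (Y : R) : R := Y / (1 + Y * flat 0 Y).

(** The second inequality is [1 - 1 / Y < exp (- 1 / Y)]. *)
Lemma ramp_den (Y : R) : 0 < 1 + Y * flat 0 Y /\ Y < 1 + Y * flat 0 Y.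
Proof.
have [Y0|Y0] := leP Y 0.
  by rewrite /flat (ltNge 0 Y) Y0 /= mulr0 addr0; lra.
have Yn0 : - Y^-1 != 0 by rewrite oppr_eq0 invr_eq0 gt_eqF.
have := expR_gt1Dx Yn0; rewrite -(flat0E Y0) => h.
have {}h : Y * (1 - Y^-1) < Y * flat 0 Y by rewrite ltr_pM2l.
have := mulr_ge0 (ltW Y0) (flat_ge0 0 Y).
by rewrite mulrBr mulr1 mulfV ?gt_eqF// in h; lra.
Qed.

Lemma ramp_id (Y : R) : Y <= 0 -> ramp Y = Y.
Proof.
by move=> Y0; rewrite /ramp /flat (ltNge 0 Y) Y0 /= mulr0 addr0 divr1.
Qed.

Lemma ramp_lt1 (Y : R) : ramp Y < 1.
Proof. by have [d0 dY] := ramp_den Y; rewrite /ramp ltr_pdivrMr// mul1r. Qed.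

Lemma ramp_ge (Y : R) : 1 <= Y -> 0 <= ramp Y /\ 1 - ramp Y <= Y^-1.
Proof.
move=> Y1; have [d0 dY] := ramp_den Y; have Y0 : 0 < Y by lra.
have Yf : Y * flat 0 Y <= Y by rewrite ger_pMr// ltW// flat0_lt1.
split; first by rewrite /ramp divr_ge0// ltW.
rewrite /ramp -[X in X - _](divff (lt0r_neq0 d0)) -mulrBl ler_pdivrMr//.
by rewrite ler_pdivlMl//; nra.
Qed.

(** As [Y^2 * f' = f] for [f = flat 0], the numerator [1 - Y^2 * f'] of the
    quotient rule is [1 - f]. *)
Lemma is_derive_ramp (Y : R) : is_derive Y (1 : R) ramp
  ((1 - flat 0 Y) / (1 + Y * flat 0 Y) ^+ 2).
Proof.
have [d0 _] := ramp_den Y; have dn0 := lt0r_neq0 d0.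
have dden := is_derive_add (is_derive_const 1 Y)
  (is_derive_mul (is_derive_var Y) (is_derive_flat 0 Y)).
have dinv := is_derive_inv (f := fun Y => 1 + Y * flat 0 Y) dn0 dden.
apply: is_derive_eq (is_derive_mul (is_derive_var Y) dinv) _.
have flat2 : flat 0 Y = Y ^+ 2 * flat 2 Y.
  rewrite /flat; case: ifPn => Y0; last by rewrite mulr0.
  by rewrite mulrA expr0 invr1 mulfV// expf_neq0// gt_eqF.
rewrite flat2 in dn0 *; rewrite oppr0 mul0r add0r.
by field; rewrite dn0.
Qed.

Lemma differentiable_times_ramp n : differentiable_times n ramp.
Proof.
have dtid := differentiable_times_var n.
apply: differentiable_times_mul => //; apply: differentiable_times_inv.
  by move=> Y; have [/lt0r_neq0] := ramp_den Y.
apply: differentiable_times_add; first exact: differentiable_times_const.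
by apply: differentiable_times_mul => //; exact: differentiable_times_flat.
Qed.

End sawtooth.

(** * The regularization function *)

Section regularization.
Context {R : realType}.

(** [phi] is the inverse of [chi o ramp], where [chi] adds a multiple of the
    staircase to a line of slope [- (mu + 1)].  The multiple is fixed by the
    requirement that [chi + mu Y] has period [4 pi], and it equals [mu] when
    [mu = period / b].  As the staircase has slope at most [1], this keeps the
    slope of [chi] at most [-1]. *)
Lemma regularization_function_sawtooth : exists (phi : R -> R) (mu : R),
  [/\ regularization_function phi,
      forall Y, 0 < phi Y
    & forall (n : nat) Y, - 2 <= Y + n.+1%:R * period <= 2 ->
        (phi Y)^-1 = mu + 2 - mu * Y - (Y + n.+1%:R * period)].
Proof.
have pi2 := @pi_ge2 R.
have [B [b [b0 dB B0 Bstep]]] := @staircase R.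
pose mu := @period R / b.
have mu0 : 0 < mu by rewrite /mu /period divr_gt0//; lra.
pose chi s : R := 1 + (mu + 1) * (1 - s) + mu * B s.
have dchi s : is_derive s (1 : R) chi (- (mu + 1) + mu * cos_bump s).
  have d1 := is_derive_mul (is_derive_const (mu + 1) s)
    (is_derive_sub (is_derive_const 1 s) (is_derive_var s)).
  have d2 := is_derive_mul (is_derive_const mu s) (dB s).
  apply: is_derive_eq
    (is_derive_add (is_derive_add (is_derive_const 1 s) d1) d2) _.
  by ring.
have dchi_le s : - (mu + 1) + mu * cos_bump s <= -1.
  by have := flat0_lt1 (- cos (s / 2)); rewrite -/(cos_bump s); nra.
have chi1 : chi 1 = 1 by rewrite /chi B0; [ring|lra].
have chi_ge s : s <= 1 -> 2 - s <= chi s.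
  move=> s1.
  suff : chi 1 + 1 <= chi s + s by rewrite chi1; lra.
  apply: (is_derive_nincr s1
    (fun r _ => is_derive_add (dchi r) (is_derive_var r))) => r _.
  by have := dchi_le r; lra.
have chi_gt1 Y : 1 < chi (ramp Y).
  by have rY := ramp_lt1 Y; have := chi_ge _ (ltW rY); lra.
have chi_neq0 Y : chi (ramp Y) != 0 by have := chi_gt1 Y; lra.
pose phi Y := (chi (ramp Y))^-1.
have phi_gt0 Y : 0 < phi Y by rewrite invr_gt0; have := chi_gt1 Y; lra.
exists phi, mu; split => //; first split.
- apply: smooth_derivatives => n; apply: differentiable_times_inv => //.
  apply: differentiable_times_comp; last exact: differentiable_times_ramp.
  apply: differentiable_timesS.
  exists (fun s => - (mu + 1) + mu * cos_bump s) => //.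
  apply: differentiable_times_add; first exact: differentiable_times_const.
  apply: differentiable_times_mul; first exact: differentiable_times_const.
  exact: differentiable_times_cos_bump.
- move=> Y; have dchir := is_derive_comp (dchi (ramp Y)) (is_derive_ramp Y).
  have dphi := is_derive_inv (f := fun Y => chi (ramp Y)) (chi_neq0 Y) dchir.
  rewrite derive1E (@derive_val _ _ _ _ _ _ _ dphi) -mulNr.
  rewrite divr_gt0 ?exprn_gt0//; last by have := chi_gt1 Y; lra.
  rewrite -mulNr mulr_gt0//; first by have := dchi_le (ramp Y); lra.
  rewrite divr_gt0 ?subr_gt0 ?flat0_lt1// exprn_gt0//.
  by have [] := ramp_den Y.
- apply/cvgrPdist_le => e e0; near=> Y.
  have Y1 : 1 <= Y by near: Y; apply: nbhs_pinfty_ge; exact: num_real.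
  have Ye : (mu + 1) / e <= Y.
    by near: Y; apply: nbhs_pinfty_ge; exact: num_real.
  have [r0 r1] := ramp_ge Y1; have rlt1 := ramp_lt1 Y.
  have chiE : chi (ramp Y) = 1 + (mu + 1) * (1 - ramp Y).
    by rewrite /chi B0 ?mulr0 ?addr0//; lra.
  have c1 := chi_gt1 Y.
  have phi1 : phi Y <= 1 by rewrite invf_le1 ?ltW//; lra.
  rewrite ger0_norm ?subr_ge0//.
  have : 1 - phi Y <= chi (ramp Y) - 1.
    have : phi Y * chi (ramp Y) = 1 by rewrite mulVf.
    by have := phi_gt0 Y; nra.
  move=> /le_trans; apply; rewrite chiE addrAC subrr add0r.
  apply: (@le_trans _ _ ((mu + 1) * Y^-1)); first by rewrite ler_pM2l//; lra.
  have Y0 : 0 < Y by lra.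
  by rewrite ler_pdivrMr// mulrC -ler_pdivrMr.
- apply/cvgrPdist_le => e e0; near=> Y.
  have Y0 : Y <= 0 by near: Y; apply: nbhs_ninfty_le; exact: num_real.
  have Ye : Y <= - e^-1 by near: Y; apply: nbhs_ninfty_le; exact: num_real.
  rewrite sub0r normrN (ger0_norm (ltW (phi_gt0 Y))) /phi ramp_id//.
  have Y1 : Y <= 1 by lra.
  have := chi_ge _ Y1.
  have eV0 : 0 < e^-1 by rewrite invr_gt0.
  move=> h; rewrite -[leRHS]invrK lef_pV2 ?posrE//; lra.
- move=> n Y Yn; rewrite /phi invrK.
  have n0 : 0 <= n%:R * @period R.
    by rewrite /period mulr_ge0//; lra.
  have YP : Y <= 0.
    by move: Yn; rewrite -(natr1 n) mulrDl mul1r /period in n0 *; lra.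
  rewrite ramp_id// /chi (Bstep _ _ Yn) /mu.
  by field; rewrite gt_eqF.
Unshelve. all: by end_near. Qed.

End regularization.

(** * Motion on the circle *)

Section circle_motion.
Context {R : realType}.
Implicit Types (f u V w : R -> R).

Lemma derive_ge_surjective f df (c : R) : 0 < c ->
  (forall x, is_derive x (1 : R) f (df x)) -> (forall x, c <= df x) ->
  forall v, exists x, f x = v.
Proof.
move=> c0 fd dfc v.
have grow x y : x <= y -> c * (y - x) <= f y - f x.
  move=> xy.
  have dg r := is_derive_sub
    (is_derive_mul (is_derive_const c r) (is_derive_var r)) (fd r).
  suff : c * y - f y <= c * x - f x by lra.
  by apply: (is_derive_nincr xy (fun r _ => dg r)) => r _; have := dfc r; lra.
(* On [-r, r] the growth bound makes [f] pass the value [v]. *)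
pose r := `|v - f 0| / c.
have r0 : 0 <= r by rewrite divr_ge0// ltW.
have cr : c * r = `|v - f 0| by rewrite mulrC divfK// gt_eqF.
have h1 := grow 0 r r0.
have Nr0 : - r <= 0 by lra.
have h2 := grow (- r) 0 Nr0.
have v1 := ler_norm (v - f 0); have v2 := ler_norm (- (v - f 0)).
rewrite normrN in v2.
have rr : - r <= r by lra.
have cf : {within `[- r, r], continuous f}.
  by apply: continuous_subspaceT => x; exact: is_derive_continuous (fd x).
have fv : Num.min (f (- r)) (f r) <= v <= Num.max (f (- r)) (f r).
  rewrite ge_min le_max; apply/andP; split; apply/orP; [left|right]; lra.
by have [x _ <-] := IVT rr cf fv; exists x.
Qed.

Lemma unit_angle (c s : R) : c ^+ 2 + s ^+ 2 = 1 ->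
  exists x, cos x = c /\ sin x = s.
Proof.
move=> cs1.
have c1 : -1 <= c <= 1 by have := sqr_ge0 s; nra.
have sE : Num.sqrt (1 - c ^+ 2) = `|s| by rewrite -cs1 addrC addKr sqrtr_sqr.
have [s0|/ltW s0] := leP 0 s.
  by exists (acos c); rewrite acosK ?in_itv//= sin_acos// sE ger0_norm.
exists (- acos c); rewrite cosN sinN acosK ?in_itv//= sin_acos// sE.
by rewrite ler0_norm// opprK.
Qed.

(** The solution of [theta' = w theta] is the inverse function of an
    antiderivative of [1 / w]; the time needed for a turn does not depend on the
    starting angle because [w] is periodic. *)
Lemma angle_flow w (w0 w1 : R) : 0 < w0 -> continuous w ->
  (forall x, w0 <= w x <= w1) -> (forall x, w (x + pi *+ 2) = w x) ->
  exists (theta : R -> R) (T : R),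
    [/\ 0 < T, forall t, is_derive t (1 : R) theta (w (theta t)),
      forall t, theta (t + T) = theta t + pi *+ 2
    & forall x, exists t, theta t = x].
Proof.
move=> w00 cw w01 wper.
have w_gt0 x : 0 < w x by have := w01 x; lra.
have cV : continuous (fun x => (w x)^-1).
  by move=> x; apply: continuousV; [exact: lt0r_neq0|exact: cw].
have [F [F0 dF]] := antiderivative cV.
have w1_gt0 : 0 < w1 by have := w01 0; lra.
have Fsurj : forall t, exists x, F x = t.
  apply: (derive_ge_surjective (c := w1^-1) _ dF); first by rewrite invr_gt0.
  by move=> x; rewrite lef_pV2 ?posrE//; have := w01 x; lra.
have Flt x y : x < y -> F x < F y.
  move=> xy; apply: (is_derive_incr xy (fun r _ => dF r)) => r _.
  by rewrite invr_gt0.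
have Finj : injective F.
  move=> x y Fxy; apply/eqP; rewrite eq_le !leNgt.
  by apply/andP; split; apply/negP => /Flt; rewrite Fxy ltxx.
have [theta thetaK] := choice Fsurj.
have FK : cancel F theta by move=> x; apply: Finj; rewrite thetaK.
have FD x : F (x + pi *+ 2) = F x + F (pi *+ 2).
  have dd y : is_derive y (1 : R) (fun x => F (x + pi *+ 2) - F x) 0.
    have shift := is_derive_add (is_derive_var y) (is_derive_const (pi *+ 2) y).
    have dshift := is_derive_comp (g := fun y => y + pi *+ 2) (dF _) shift.
    apply: is_derive_eq (is_derive_sub dshift (dF y)) _.
    by rewrite wper; ring.
  suff : F (x + pi *+ 2) - F x = F (0 + pi *+ 2) - F 0.
    by rewrite add0r F0 subr0 => <-; rewrite [F x + _]addrC subrK.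
  exact: (@is_derive_0_is_cst _ (fun x => F (x + pi *+ 2) - F x)).
exists theta, (F (pi *+ 2)); split.
- by rewrite -F0; apply: Flt; have := @pi_gt0 R; rewrite mulr2n; lra.
- move=> t.
  have nearK : {near theta t, cancel F theta}.
    exact: (@filterE _ (nbhs (theta t)) _ _ FK).
  have nearC : {near theta t, continuous F}.
    apply: (@filterE _ (nbhs (theta t))) => x.
    exact: is_derive_continuous (dF x).
  have wV0 : (w (theta t))^-1 != 0 by rewrite invr_eq0 gt_eqF.
  have := is_derive_inverse nearK nearC (dF (theta t)) wV0.
  by rewrite thetaK invrK.
- by move=> t; apply: Finj; rewrite thetaK FD thetaK.
- by move=> x; exists (F x).
Qed.

(** Turning the solution back by an antiderivative [A] of its angular speed
    gives a constant point, so the solution is the point of angle [A t] up to a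
    constant, and [A] takes every value. *)
Lemma circle_solution_surjective u V w (w0 : R) : 0 < w0 -> continuous w ->
  (forall t, w0 <= w t) ->
  (forall t, u t ^+ 2 + V t ^+ 2 = 1) ->
  (forall t, is_derive t (1 : R) u (- V t * w t)) ->
  (forall t, is_derive t (1 : R) V (u t * w t)) ->
  forall x y, x ^+ 2 + y ^+ 2 = 1 -> exists t, u t = x /\ V t = y.
Proof.
move=> w00 cw w0w uV1 du dV x y xy1.
have [A [A0 dA]] := antiderivative cw.
have dcos t := is_derive_comp (is_derive_cos (A t)) (dA t).
have dsin t := is_derive_comp (is_derive_sin (A t)) (dA t).
have pE t : u t * cos (A t) + V t * sin (A t) = u 0.
  have -> : u 0 = u 0 * cos (A 0) + V 0 * sin (A 0).
    by rewrite A0 cos0 sin0 mulr0 mulr1 addr0.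
  apply: (@is_derive_0_is_cst _ (fun t => u t * cos (A t) + V t * sin (A t))).
  move=> s; apply: is_derive_eq (is_derive_add (is_derive_mul (du s) (dcos s))
    (is_derive_mul (dV s) (dsin s))) _; ring.
have qE t : V t * cos (A t) - u t * sin (A t) = V 0.
  have -> : V 0 = V 0 * cos (A 0) - u 0 * sin (A 0).
    by rewrite A0 cos0 sin0 mulr0 mulr1 subr0.
  apply: (@is_derive_0_is_cst _ (fun t => V t * cos (A t) - u t * sin (A t))).
  move=> s; apply: is_derive_eq (is_derive_sub (is_derive_mul (dV s) (dcos s))
    (is_derive_mul (du s) (dsin s))) _; ring.
have [|al [cosal sinal]] := @unit_angle (x * u 0 + y * V 0) (y * u 0 - x * V 0).
  rewrite (_ : _ + _ = (x ^+ 2 + y ^+ 2) * (u 0 ^+ 2 + V 0 ^+ 2)); last by ring.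
  by rewrite xy1 uV1 mulr1.
have [t At] := derive_ge_surjective w00 dA w0w al.
exists t; have := pE t; have := qE t; rewrite At => q p.
have cs1 := cos2Dsin2 al; have uV0 := uV1 0.
have ut : u t = u 0 * cos al - V 0 * sin al.
  by rewrite -p -q -[LHS]mulr1 -cs1; ring.
have Vt : V t = V 0 * cos al + u 0 * sin al.
  by rewrite -p -q -[LHS]mulr1 -cs1; ring.
rewrite ut Vt cosal sinal; split.
  by rewrite -[RHS]mulr1 -uV0; ring.
by rewrite -[RHS]mulr1 -uV0; ring.
Qed.

Lemma is_derive_cvgP (W : normedModType R) (g : R -> W) t (d : W) :
  is_derive t (1 : R) g d <->
  h^-1 *: ((g \o shift t) (h *: (1 : R)) - g t) @[h --> 0^'] --> d.
Proof.
split=> [[dg <-]|gd]; first exact: dg.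
apply: DeriveDef; first exact: cvgP gd.
by apply: cvg_lim gd; exact: norm_hausdorff.
Qed.

Lemma is_derive_pairP (g : R -> R * R) t (d : R * R) :
  is_derive t (1 : R) g d <->
  is_derive t (1 : R) (fun s => (g s).1) d.1 /\
  is_derive t (1 : R) (fun s => (g s).2) d.2.
Proof.
split=> [/is_derive_cvgP gd|[/is_derive_cvgP g1 /is_derive_cvgP g2]].
  split; apply/is_derive_cvgP.
    exact: (cvg_comp _ _ gd (@cvg_fst _ _ (nbhs d.1) (nbhs d.2) _)).
  exact: (cvg_comp _ _ gd (@cvg_snd _ _ (nbhs d.1) (nbhs d.2) _)).
apply/is_derive_cvgP.
exact: (@cvg_pair _ _ _ _ (nbhs d.1) (nbhs d.2) _ _ _ _ _ g1 g2).
Qed.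

End circle_motion.

(** * The limit cycle of a strip *)

Section limit_cycle_of_strip.
Context {R : realType}.
Variables (Z : R * R -> R * R) (phi : R -> R) (l c : R).
Hypothesis l_gt0 : 0 < l.
Hypothesis phi_gt0 : forall Y, 0 < phi Y.
Hypothesis phi_le : {homo phi : x y / x <= y}.
Hypothesis cont_phi : continuous phi.

Let u (z : R * R) := z.1 / l.
Let V (z : R * R) := z.2 / l + c.

Hypothesis Zstrip : forall z, - 2 < V z < 2 ->
  Z z = (l * (l * phi (z.2 / l) * (1 - u z ^+ 2 - 2 * V z + u z * V z)),
         l * (l * phi (z.2 / l) * (u z * (2 - u z - V z)))).

Definition strip_circle (l c : R) : set (R * R) :=
  [set z | (z.1 / l) ^+ 2 + (z.2 / l + c) ^+ 2 = 1].

Let ln0 : l != 0. Proof. exact: lt0r_neq0. Qed.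

Let point_u x y : u (l * x, l * (y - c)) = x.
Proof. by rewrite /u /= mulrC mulKf. Qed.

Let point_Y y : l * (y - c) / l = y - c.
Proof. by rewrite mulrC mulKf. Qed.

Let point_V x y : V (l * x, l * (y - c)) = y.
Proof. by rewrite /V /= point_Y subrK. Qed.

Let pointK z : (l * u z, l * (V z - c)) = z.
Proof.
rewrite /u /V addrK; case: z => x y /=.
by congr pair; rewrite mulrC divfK.
Qed.

(** [2 - x - y] is the angular speed of the model on the unit circle. *)
Lemma sum_cos_sin_le (x y : R) : x ^+ 2 + y ^+ 2 = 1 ->
  1 / 2 <= 2 - x - y <= 4 /\ - 1 <= y <= 1.
Proof.
move=> xy; have := sqr_ge0 (x - y); have := sqr_ge0 x; have := sqr_ge0 y.
by move=> ? ? ?; split; apply/andP; split; nra.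
Qed.

Let phi_strip y : - 1 <= y <= 1 -> phi (- 1 - c) <= phi (y - c) <= phi (1 - c).
Proof. by move=> y1; apply/andP; split; apply: phi_le; lra. Qed.

Let phic_gt0 : 0 < l * phi (- 1 - c) / 2.
Proof. by rewrite divr_gt0// mulr_gt0. Qed.

Lemma strip_circle_periodic : periodic_orbit Z (strip_circle l c).
Proof.
pose w x := l * phi (sin x - c) * (2 - cos x - sin x) : R.
have cs1 (x : R) : cos x ^+ 2 + sin x ^+ 2 = 1 by exact: cos2Dsin2.
have cw : continuous w.
  have cphi : continuous (fun x => phi (sin x - c)).
    move=> x; apply: (@continuous_comp _ _ _ (fun x => sin x - c) phi).
      apply: continuous_addf; first exact: continuous_sin.
      exact: continuous_constf.
    exact: cont_phi.
  apply: continuous_mulf.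
    apply: continuous_mulf => //; exact: continuous_constf.
  apply: continuous_addf; last exact: continuous_oppf (@continuous_sin R).
  apply: continuous_addf; first exact: continuous_constf.
  exact: continuous_oppf (@continuous_cos R).
have w01 x : l * phi (- 1 - c) / 2 <= w x <= l * phi (1 - c) * 4.
  have [/andP[h1 h2] h3] := sum_cos_sin_le (cs1 x).
  have /andP[p1 p2] := phi_strip h3; rewrite /w.
  rewrite -!mulrA !ler_pM2l//; apply/andP; split; apply: ler_pM => //; try lra.
  - exact/ltW/phi_gt0.
  - exact/ltW/phi_gt0.
have wper x : w (x + pi *+ 2) = w x by rewrite /w cosD2pi sinD2pi.
have [th [T [T0 dth thT thsurj]]] := angle_flow phic_gt0 cw w01 wper.
pose g t := (l * cos (th t), l * (sin (th t) - c)).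
have gsurj x y : x ^+ 2 + y ^+ 2 = 1 -> exists t, g t = (l * x, l * (y - c)).
  move=> /unit_angle[a [<- <-]]; have [t ta] := thsurj a.
  by exists t; rewrite /g ta.
exists g, T; split => //.
- move=> t; apply/is_derive_pairP => /=.
  have [_ V1] := sum_cos_sin_le (cs1 (th t)).
  rewrite Zstrip ?point_V; last by lra.
  rewrite point_u point_Y /=.
  have dcos := is_derive_comp (is_derive_cos (th t)) (dth t).
  have dsin := is_derive_comp (is_derive_sin (th t)) (dth t).
  split.
    apply: is_derive_eq (is_derive_mul (is_derive_const l t) dcos) _.
    have -> : 1 - cos (th t) ^+ 2 = sin (th t) ^+ 2.
      by rewrite -(cs1 (th t)) addrC addKr.
    by rewrite /w; ring.
  apply: is_derive_eq (is_derive_mul (is_derive_const l t)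
    (is_derive_sub dsin (is_derive_const c t))) _.
  by rewrite /w; ring.
- by move=> t; rewrite /g thT cosD2pi sinD2pi.
- apply: contrapT => /forallNP gcst.
  have gE t : g t = g 0 by apply: contrapT; exact: gcst.
  have [|t1 g1] := gsurj 1 0; first by ring.
  have [|t2 g2] := gsurj (- 1) 0; first by ring.
  by move: g1; rewrite (gE t1) -(gE t2) g2 => -[/(mulfI ln0)]; lra.
- apply/seteqP; split => z.
    move=> /gsurj[t gt]; exists t => //; rewrite gt.
    exact: pointK.
  move=> [t _ <-]; rewrite /strip_circle /=.
  have := point_u (cos (th t)) (sin (th t)); rewrite /u /= => ->.
  by rewrite point_Y subrK.
Qed.

(** In the rescaled coordinates, a periodic orbit that meets the trapping region
    stays on the circle; its angular speed is bounded below, so it covers it. *)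
Lemma strip_circle_limit_cycle : limit_cycle Z (strip_circle l c).
Proof.
split; first exact: strip_circle_periodic.
have cu : continuous u.
  apply: continuous_mulf; last exact: continuous_constf.
  by move=> z; exact: cvg_fst.
have cV : continuous V.
  apply: continuous_addf; last exact: continuous_constf.
  apply: continuous_mulf; last exact: continuous_constf.
  by move=> z; exact: cvg_snd.
exists [set z | trap (u z) (V z)]; split.
- exact: open_trap.
- move=> z Oz; have E : u z ^+ 2 + V z ^+ 2 = 1 := Oz.
  have [_ Vz] := sum_cos_sin_le E.
  have E0 : u z ^+ 2 + V z ^+ 2 - 1 = 0 by rewrite E subrr.
  suff : trap (u z) (V z) by [].
  rewrite /trap E0 mulr0 oppr_lt0; have V2 : 0 < 2 - V z by lra.
  by rewrite exprn_gt0//; split => //; lra.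
move=> O' [g [T [ig T0 gT [t1 nconst] ->{O'}]]] [_ [[t0 _ <-] /= trap0]].
have dg1 t := (is_derive_pairP _ _ _).1 (ig t).
have dV t : is_derive t (1 : R) (fun t => V (g t)) ((Z (g t)).2 / l).
  apply: is_derive_eq (is_derive_add
    (is_derive_mul (dg1 t).2 (is_derive_const l^-1 t)) (is_derive_const c t)) _.
  by ring.
have du t : is_derive t (1 : R) (fun t => u (g t)) ((Z (g t)).1 / l).
  apply: is_derive_eq
    (is_derive_mul (dg1 t).1 (is_derive_const l^-1 t)) _.
  by ring.
pose a t := l * phi ((g t).2 / l).
have a_gt0 t : 0 < a t by rewrite /a mulr_gt0.
have cug : continuous (fun t => u (g t)).
  by move=> t; exact: is_derive_continuous (du t).
have cVg : continuous (fun t => V (g t)).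
  by move=> t; exact: is_derive_continuous (dV t).
have du' t : - 2 < V (g t) < 2 -> is_derive t (1 : R) (fun t => u (g t))
    (a t * (1 - u (g t) ^+ 2 - 2 * V (g t) + u (g t) * V (g t))).
  by move=> Vt; apply: is_derive_eq (du t) _; rewrite Zstrip//= mulrC mulKf.
have dV' t : - 2 < V (g t) < 2 -> is_derive t (1 : R) (fun t => V (g t))
    (a t * (u (g t) * (2 - u (g t) - V (g t)))).
  by move=> Vt; apply: is_derive_eq (dV t) _; rewrite Zstrip//= mulrC mulKf.
have guV t : g t = (l * u (g t), l * (V (g t) - c)) by rewrite pointK.
have onO t : u (g t) ^+ 2 + V (g t) ^+ 2 = 1.
  apply: (trapped_periodic a_gt0 cug cVg du' dV' T0 _ trap0).
    by move=> s; rewrite gT.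
  exists t1 => -[eu eV]; apply: nconst.
  by rewrite (guV t1) (guV 0) eu eV.
apply/seteqP; split=> [_ [t _ <-]|z Oz]; first exact: onO.
pose w t := a t * (2 - u (g t) - V (g t)).
have Vb t : - 2 < V (g t) < 2 by have [_] := sum_cos_sin_le (onO t); lra.
have cw : continuous w.
  have cphi : continuous (fun t => phi ((g t).2 / l)).
    move=> t; apply: (@continuous_comp _ _ _ (fun t => (g t).2 / l) phi).
      have -> : (fun t => (g t).2 / l) = (fun t => V (g t) - c).
        by apply/funext => s; rewrite /V addrK.
      apply: continuous_addf => //; exact: continuous_constf.
    exact: cont_phi.
  apply: continuous_mulf.
    apply: continuous_mulf => //; exact: continuous_constf.
  apply: continuous_addf; last exact: continuous_oppf cVg.
  apply: continuous_addf; first exact: continuous_constf.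
  exact: continuous_oppf cug.
have w0w t : l * phi (- 1 - c) / 2 <= w t.
  have [/andP[h1 h2] h3] := sum_cos_sin_le (onO t).
  have /andP[p1 p2] := phi_strip h3; rewrite /w /a -!mulrA ler_pM2l//.
  apply: ler_pM => //; first exact/ltW/phi_gt0.
    by move: p1; rewrite /V addrK.
  by lra.
have du2 t : is_derive t (1 : R) (fun t => u (g t)) (- V (g t) * w t).
  apply: is_derive_eq (du' t (Vb t)) _; rewrite /w.
  have -> : 1 - u (g t) ^+ 2 = V (g t) ^+ 2 by rewrite -(onO t) addrC addKr.
  by ring.
have dV2 t : is_derive t (1 : R) (fun t => V (g t)) (u (g t) * w t).
  by apply: is_derive_eq (dV' t (Vb t)) _; rewrite /w; ring.
have [t [ut Vt]] := circle_solution_surjective phic_gt0 cw w0w onO du2 dV2 Oz.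
by exists t => //; rewrite guV ut Vt; exact: pointK.
Qed.

End limit_cycle_of_strip.

(** * The fields and the domain *)

Section homogeneous_fields.
Context {R : realType}.

(** For [d <= 2] these are forms of degree two in the coordinates and the
    parameter; this homogeneity makes the parameter a scale. *)
Lemma homogeneous_smooth_poly_family (d : nat) (a : nat -> nat -> R)
    (f : R * R -> R -> R) :
  (forall z l, f z l = \sum_(i < d.+1) \sum_(j < d.+1 | (i + j <= d)%N)
    a i j * l ^+ (2 - (i + j)) * z.1 ^+ i * z.2 ^+ j) ->
  smooth_poly_family d f.
Proof.
move=> fE; exists (fun i j l => a i j * l ^+ (2 - (i + j))); split=> // i j.
apply: smooth_derivatives => n; apply: differentiable_times_mul.
  exact: differentiable_times_const.
elim: (2 - (i + j))%N => [|m IH].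
  rewrite (_ : (fun _ => _) = fun=> 1); first exact: differentiable_times_const.
  by apply/funext => x; rewrite expr0.
rewrite (_ : (fun _ => _) = fun x => x * x ^+ m).
  by apply: differentiable_times_mul => //; exact: differentiable_times_var.
by apply/funext => x; rewrite exprS.
Qed.

Lemma quadratic_family (a00 a10 a01 a20 a11 a02 : R) :
  smooth_poly_family 2 (fun z l => a00 * l ^+ 2 + a10 * (l * z.1) +
    a01 * (l * z.2) + a20 * z.1 ^+ 2 + a11 * (z.1 * z.2) + a02 * z.2 ^+ 2).
Proof.
pose a i j :=
  nth 0 (nth [::] [:: [:: a00; a01; a02]; [:: a10; a11]; [:: a20]] i) j.
apply: (@homogeneous_smooth_poly_family 2 a) => z l.
rewrite !big_ord_recl !big_ord0 /=.
do !rewrite big_mkcond /= !big_ord_recl !big_ord0 /=.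
by rewrite /a /= /bump /=; ring.
Qed.

Lemma linear_family (a00 a10 a01 : R) :
  smooth_poly_family 1 (fun z l => a00 * l ^+ 2 + a10 * (l * z.1) +
    a01 * (l * z.2)).
Proof.
pose a i j := nth 0 (nth [::] [:: [:: a00; a01]; [:: a10]] i) j.
apply: (@homogeneous_smooth_poly_family 1 a) => z l.
rewrite !big_ord_recl !big_ord0 /=.
do !rewrite big_mkcond /= !big_ord_recl !big_ord0 /=.
by rewrite /a /= /bump /=; ring.
Qed.

Definition lower_field (z : R * R) (l : R) : R * R :=
  (2 * l ^+ 2 - l * z.1, l * z.1).

(** The summand added to [lower_field] is [Q + (mu Y - (mu + 2)) W], in
    homogeneous form. *)
Definition upper_field (mu : R) (z : R * R) (l : R) : R * R :=
  lower_field z l +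
  (l ^+ 2 - z.1 ^+ 2 + (mu * z.2 - (mu + 2) * l) * (2 * l - z.1),
   2 * (l * z.1) - z.1 ^+ 2 + (mu * z.2 - (mu + 2) * l) * z.1).

Lemma lower_field_linear : linear_vector_field lower_field.
Proof.
split.
  rewrite (_ : (fun z l => _) = fun (z : R * R) l =>
    2 * l ^+ 2 + -1 * (l * z.1) + 0 * (l * z.2)); first exact: linear_family.
  by apply/funext => z; apply/funext => l /=; ring.
rewrite (_ : (fun z l => _) = fun (z : R * R) l =>
  0 * l ^+ 2 + 1 * (l * z.1) + 0 * (l * z.2)); first exact: linear_family.
by apply/funext => z; apply/funext => l /=; ring.
Qed.

Lemma upper_field_quadratic (mu : R) : quadratic_vector_field (upper_field mu).
Proof.
split.
  rewrite (_ : (fun z l => _) = fun (z : R * R) l =>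
    (- (2 * mu) - 1) * l ^+ 2 + (mu + 1) * (l * z.1) + 2 * mu * (l * z.2) +
    - 1 * z.1 ^+ 2 + (- mu) * (z.1 * z.2) + 0 * z.2 ^+ 2).
    exact: quadratic_family.
  by apply/funext => z; apply/funext => l /=; ring.
rewrite (_ : (fun z l => _) = fun (z : R * R) l =>
  0 * l ^+ 2 + (1 - mu) * (l * z.1) + 0 * (l * z.2) +
  - 1 * z.1 ^+ 2 + mu * (z.1 * z.2) + 0 * z.2 ^+ 2).
  exact: quadratic_family.
by apply/funext => z; apply/funext => l /=; ring.
Qed.

(** The field is [phi] times the sum of [(1 / phi) * lower_field] and the
    difference of the two fields.  On a strip the multiplier of [lower_field]
    reduces to [- (Y + c)], and the local model appears. *)
Lemma regularized_field_strip (mu : R) (phi : R -> R) (l c : R) (z : R * R) :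
  l != 0 -> phi (z.2 / l) != 0 ->
  (phi (z.2 / l))^-1 = mu + 2 - mu * (z.2 / l) - (z.2 / l + c) ->
  regularized_vector_field (upper_field mu) lower_field phi l l z =
  (l * (l * phi (z.2 / l) * (1 - (z.1 / l) ^+ 2 - 2 * (z.2 / l + c) +
     z.1 / l * (z.2 / l + c))),
   l * (l * phi (z.2 / l) * (z.1 / l * (2 - z.1 / l - (z.2 / l + c))))).
Proof.
move=> l0; case: z => x y /=; set Y := y / l; set p := phi Y => p0 pV.
have yE : y = l * Y by rewrite /Y mulrC divfK.
have xE : x = l * (x / l) by rewrite mulrC divfK.
set X := x / l in xE *.
have pK : p * (mu + 2 - mu * Y - (Y + c)) = 1 by rewrite -pV divff.
rewrite /regularized_vector_field /upper_field /lower_field /= -/Y -/p xE yE.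
congr pair => /=.
  rewrite /GRing.scale/=.
  have e : l ^+ 2 * (2 - X) * (p * (mu + 2 - mu * Y - (Y + c)) - 1) = 0.
    by rewrite pK subrr mulr0.
  by apply/eqP; rewrite -subr_eq0 -[X in _ == X]oppr0 -e; apply/eqP; ring.
rewrite /GRing.scale/=.
have e : l ^+ 2 * X * (p * (mu + 2 - mu * Y - (Y + c)) - 1) = 0.
  by rewrite pK subrr mulr0.
by apply/eqP; rewrite -subr_eq0 -[X in _ == X]oppr0 -e; apply/eqP; ring.
Qed.

Lemma compact_domain_ball : compact_domain (closure (ball (0 : R * R) 1)).
Proof.
split; last first.
  exists (ball (0 : R * R) 1); split => //.
  - exact: ball_open.
  - have -> : ball (0 : R * R) 1 =
        \bigcup_(z in ball (0 : R * R) 1) ((fun t : R => t *: z) @` `[0, 1]).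
      apply/seteqP; split=> [z z1|_ [z z1 [t + <-]]].
        by exists z => //; exists 1; rewrite ?scale1r//= in_itv/= ler01 lexx.
      rewrite /= in_itv/= => /andP[t0 t1]; move: z1.
      rewrite -!ball_normE /= !sub0r !normrN normrZ ger0_norm//.
      by apply: le_lt_trans; rewrite ler_piMl.
    apply: bigcup_connected.
      exists 0 => z _; exists 0; rewrite ?scale0r//= in_itv/= lexx ler01//.
    move=> z _; apply: connected_continuous_connected.
      exact: segment_connected.
    apply: continuous_subspaceT => t; exact: scalel_continuous.
  - by exists 0; exact: ballxx.
have cbox : compact ((`[-1, 1] : set R) `*` (`[-1, 1] : set R)).
  by apply: compact_setX; exact: segment_compact.
apply: (subclosed_compact _ cbox); first exact: closed_closure.
apply: (subset_trans
  (B := closure ((`[-1, 1] : set R) `*` (`[-1, 1] : set R)))).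
  apply: closure_subset => -[x y] [/=]; rewrite /ball/= !sub0r !normrN.
  by rewrite !in_itv/= -!ler_norml => /ltW ? /ltW.
rewrite -(proj1 (closure_id _))//.
exact: compact_closed (@norm_hausdorff _ _) cbox.
Qed.

End homogeneous_fields.

Theorem theorem1p1 (R : realType) :
  exists (Zp Zm : R * R -> R -> R * R) (U : set (R * R)),
    [/\ quadratic_vector_field Zp,
        linear_vector_field Zm,
        compact_domain U
      & forall k : nat,
          exists (epsk : R) (phik lck : R -> R),
            [/\ 0 < epsk,
                regularization_function phik,
                {within `[0, epsk[, continuous lck}
              & forall eps : R, 0 < eps < epsk ->
                  at_least_limit_cycles_in k
                    (regularized_vector_field Zp Zm phik eps (lck eps)) U]].
Proof.
have [phi [mu [reg phi_gt0 phi_strip]]] := @regularization_function_sawtooth R.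
have [phi_smooth dphi_gt0 _ _] := reg.
have dphi Y : is_derive Y (1 : R) phi (phi^`() Y).
  by rewrite derive1E; apply: derivableP; exact: (phi_smooth 0%N).
have phi_le : {homo phi : x y / x <= y}.
  move=> x y; rewrite le_eqVlt => /orP[/eqP ->//|xy].
  by apply/ltW/(is_derive_incr xy (fun r _ => dphi r)).
have cphi : continuous phi by move=> Y; exact: is_derive_continuous (dphi Y).
exists (upper_field mu), lower_field, (closure (ball (0 : R * R) 1)); split.
- exact: upper_field_quadratic.
- exact: lower_field_linear.
- exact: compact_domain_ball.
move=> k; have P0 : 0 < @period R by rewrite /period mulr_gt0// pi_gt0.
have kP0 : 0 <= k%:R * @period R by rewrite mulr_ge0// ltW.
have K0 : 0 < 2 + k%:R * @period R by lra.
(* The [k]-th circle, at scale 1, is within distance [1 + k * period] of the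
   origin in the sup norm. *)
exists (2 + k%:R * period)^-1, phi, id; split => //.
- by rewrite invr_gt0.
- by apply: continuous_subspaceT => x; exact: cvg_id.
move=> eps /andP[eps0 epsk].
have eps1 : eps * (2 + k%:R * period) < 1 by rewrite -ltr_pdivlMr// div1r.
exists (fun i : 'I_k => strip_circle eps (i.+1%:R * period)); split.
  move=> i j Oij; apply: ord_inj.
  have : strip_circle eps (i.+1%:R * period)
      (eps, - (eps * (i.+1%:R * period))).
    rewrite /strip_circle /= divff ?gt_eqF// mulNr mulrC mulKf ?gt_eqF//.
    by rewrite addNr expr1n expr0n addr0.
  rewrite Oij /strip_circle /= divff ?gt_eqF// mulNr mulrC mulKf ?gt_eqF//.
  rewrite expr1n -[RHS]addr0 => /addrI/eqP; rewrite sqrf_eq0 addrC subr_eq0.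
  by rewrite (inj_eq (mulIf (lt0r_neq0 P0))) eqr_nat eqSS => /eqP.
move=> i; split.
  apply: (strip_circle_limit_cycle eps0 phi_gt0 phi_le cphi) => z Vz.
  move: Vz => /andP[/ltW V1 /ltW V2].
  have phiV := phi_strip i (z.2 / eps).
  apply: (regularized_field_strip (lt0r_neq0 eps0) (lt0r_neq0 (phi_gt0 _))).
  by apply: phiV; rewrite V1.
move=> z Oz; apply: subset_closure.
set c := i.+1%:R * period in Oz.
have c0 : 0 <= c by rewrite /c mulr_ge0// ltW.
have ck : c <= k%:R * period by rewrite /c ler_pM2r// ler_nat.
have [u1 V1] : -1 <= z.1 / eps <= 1 /\ -1 <= z.2 / eps + c <= 1.
  move: Oz; rewrite /strip_circle /= => Oz.
  have := sqr_ge0 (z.1 / eps); have := sqr_ge0 (z.2 / eps + c).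
  by move=> ? ?; split; apply/andP; split; nra.
have z1E : z.1 = eps * (z.1 / eps) by rewrite mulrC divfK ?gt_eqF.
have z2E : z.2 = eps * (z.2 / eps) by rewrite mulrC divfK ?gt_eqF.
move: (z.1 / eps) (z.2 / eps) u1 V1 z1E z2E => u Y u1 V1 z1E z2E.
split; rewrite /ball/= sub0r normrN ltr_norml ?z1E ?z2E; nra.
Qed.
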